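(* Let $p(x),q(x)\in\mathcal{P}$, and let $r,s,k$ denote positive integers. (1) If $3^r+1 = \frac{p(3)}{q(3)}$, then $p(x) = (x^r+1)q(x)$. (2) If $3^{rk} + 3^{(r-1)k} + \dots + 3^k +1 = \frac{p(3)}{q(3)}$, then \[ p(x) = (x^{rk}+x^{(r-1)k} + \dots + x^k + 1)q(x) = \frac{x^{(r+1)k} - 1}{x^k -1}\, q(x). \] (3) If $3^{2rk} - 3^{(2r-1)k} + \dots - 3^k +1 = \frac{p(3)}{q(3)}$ (alternating signs), then \[ p(x) = (x^{2rk}-x^{(2r-1)k} + \dots - x^k + 1)q(x) = \frac{x^{(2r+1)k} + 1}{x^k +1}\, q(x). \] (4) If $r > s > 0$ and $3^r - 3^s + 1 = \frac{p(3)}{q(3)}$, then $p(x) = (x^r-x^s+1)q(x)$. In each of these four cases (for all admissible values of the parameters), there exist $p(x), q(x) \in \mathcal P$ which satisfy the particular condition, i.e. for which the integer in the hypothesis equals $\frac{p(3)}{q(3)}$.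
   Context: $\mathcal P$ denotes the set of Newman polynomials, i.e. polynomials with all coefficients in $\{0,1\}$ and constant term $1$ (including the constant polynomial $1$). *)

(* Defs.v *)
From HB Require Import structures.
From mathcomp Require Import all_boot all_order all_algebra.
Set Implicit Arguments.
Unset Strict Implicit.
Unset Printing Implicit Defensive.
Import GRing.Theory Num.Theory.
Local Open Scope ring_scope.

Definition newman : {pred {poly int}} :=
  [pred p : {poly int} | (p \is a polyOver (pred2 (0 : int) 1)) && (p`_0 == 1)].

(* The class of p in Frac(Z[x]); this is where quotients of polynomials such as
   ('X^n - 1) / ('X^k - 1) are formed. *)
Notation "p %:F" := (FracField.tofrac p) : ring_scope.

(* Main.v *)
(* Clear denominators in p(3) = N(3) q(3) so that both sides are a sum
   of at most two shifted Newman polynomials evaluated at 3.  Such sums have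
   coefficients in {0,1,2}, so uniqueness of ternary expansions lifts the
   numerical identity to an identity of polynomials. *)
Require Import Defs.
From mathcomp Require Import all_boot all_order all_algebra.
From mathcomp Require Import zify ring.
Import GRing.Theory Num.Theory.
Local Open Scope ring_scope.

(** Modulo [b] only the constant coefficient survives in [d.[b]], so [b] divides it and the bound
    makes it zero. The bound also gives [b > 0], so the remaining quotient vanishes at [b] and
    induction applies. *)
Lemma root_small_coef_eq0 (b : int) (d : {poly int}) :
  (forall i, `|d`_i| < b) -> d.[b] = 0 -> d = 0.
Proof.
elim/poly_ind: d => [//|d c IHd] small.
rewrite hornerMXaddC => db0.
have c_small : `|c| < b by have := small 0%N; rewrite coefD coefMX coefC /= add0r.
have [d0 c0] : d.[b] = 0 /\ c = 0.
  move: d.[b] db0 => e db0.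
  have e_cases : e = 0 \/ 1 <= e \/ e <= -1 by lia.
  by case: e_cases => [|[|]]; nia.
rewrite c0 addr0 IHd ?mul0r // => i.
by have := small i.+1; rewrite coefD coefMX coefC /= addr0.
Qed.

(** Digits in [[0, b)] differ by less than [b] in absolute value, so the previous lemma applies to
    [A - B]. *)
Lemma digits_inj (b : int) (A B : {poly int}) :
  (forall i, 0 <= A`_i < b) -> (forall i, 0 <= B`_i < b) ->
  A.[b] = B.[b] -> A = B.
Proof.
move=> dA dB eqAB; apply/eqP; rewrite -subr_eq0; apply/eqP.
apply: (@root_small_coef_eq0 b) => [i|]; last by rewrite hornerD hornerN eqAB subrr.
by rewrite coefB; move: A`_i B`_i (dA i) (dB i) => x y; lia.
Qed.

Lemma newmanP (p : {poly int}) :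
  reflect ((forall i, 0 <= p`_i <= 1) /\ p`_0 = 1) (p \in newman).
Proof.
rewrite inE /=; apply: (iffP andP) => [[/(all_nthP 0) dp /eqP p0]|[dp p0]].
  split=> // i; have [lt_ip|/(nth_default 0)-> //] := ltnP i (size p).
  by have := dp i lt_ip; rewrite inE /= => /orP[] /eqP ->.
rewrite p0; split=> //; apply/(all_nthP 0) => i _; rewrite inE /=.
by move: p`_i (dp i) => x x01; have [->|->] : x = 0 \/ x = 1 by lia.
Qed.

Lemma newman_digit (p : {poly int}) i : p \in newman -> 0 <= p`_i < 3.
Proof. by case/newmanP=> /(_ i) + _; move: p`_i => x; lia. Qed.

Lemma newman_addXn_digit (n : nat) (p q : {poly int}) i :
  p \in newman -> q \in newman -> 0 <= ('X^n * p + q)`_i < 3.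
Proof.
case/newmanP=> dp _ /newmanP[dq _]; rewrite coefD coefXnM.
by move: q`_i p`_(i - n) (dq i) (dp (i - n)%N) => x y; case: ifP => _; lia.
Qed.

Lemma newman_horner3_neq0 (q : {poly int}) : q \in newman -> q.[3] != 0.
Proof.
move=> qN; apply/eqP => q3.
have q0 : q = 0.
  by apply: root_small_coef_eq0 q3 => i; move: q`_i (newman_digit q i qN) => x; lia.
by case/newmanP: qN; rewrite q0 coef0.
Qed.

(** Trades the rational hypothesis for an equality of integer values at 3. It serves in one
    direction to lift identities and in the other to check witnesses. Division by zero is total in
    [rat], hence the need for [q.[3] != 0]. *)
Lemma newman_quotP (N p q : {poly int}) : q \in newman ->
  (N.[3])%:Q = (p.[3])%:Q / (q.[3])%:Q <-> p.[3] = (N * q).[3].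
Proof.
move=> /newman_horner3_neq0 q3; have q3Q : (q.[3])%:Q != 0 by rewrite intr_eq0.
rewrite hornerM; split=> [eqN|->]; last by rewrite intrM mulfK.
by apply/eqP; rewrite -(eqr_int rat) intrM eqN divfK.
Qed.

Lemma XnaddC_neq0 (R : nzRingType) (n : nat) (c : R) :
  (0 < n)%N -> 'X^n + c%:P != 0 :> {poly R}.
Proof. by move=> n_gt0; rewrite -size_poly_eq0 size_XnaddC. Qed.

Lemma frac_quotE (p q A B : {poly int}) :
  B != 0 -> p * B = A * q -> p%:F = A%:F / B%:F * q%:F.
Proof.
move=> B0 eqAB; have BF : B%:F != 0 by rewrite tofrac_eq0.
by apply: (mulIf BF); rewrite mulrAC divfK // -!tofracM eqAB.
Qed.

Lemma geom_sum_mul (R : comNzRingType) (x : R) (n k : nat) :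
  (\sum_(0 <= i < n) x ^+ (i * k)) * (x ^+ k - 1) = x ^+ (n * k) - 1.
Proof.
rewrite mulrC mulnC exprM [RHS]subrX1 big_mkord; congr (_ * _).
by apply: eq_bigr => i _; rewrite mulnC exprM.
Qed.

Lemma alt_geom_sum_mul (R : comNzRingType) (x : R) (r k : nat) :
  (\sum_(0 <= i < (2 * r).+1) (-1) ^+ i * x ^+ (i * k)) * (x ^+ k + 1)
    = x ^+ ((2 * r).+1 * k) + 1.
Proof.
have := subrX1 (- x ^+ k) (2 * r).+1.
(* The number of terms is odd, so the power of [-1] is [-1]; both sides of the factorization then
   carry a minus sign, which cancels. *)
rewrite exprNn -signr_odd /= oddM /= expr1 mulN1r -!opprD mulNr => /oppr_inj.
rewrite -exprM (mulnC k) => ->; rewrite mulrC big_mkord; congr (_ * _).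
by apply: eq_bigr => i _; rewrite [RHS]exprNn (mulnC i) exprM.
Qed.

(** The Newman polynomial [('X^n - 1) / ('X - 1)], from which most witnesses are built. *)
Definition ones (n : nat) : {poly int} := \poly_(i < n) 1.

Lemma ones_mul (n : nat) : ones n * ('X - 1) = 'X^n - 1.
Proof.
rewrite mulrC subrX1 /ones poly_def; congr (_ * _).
by apply: eq_bigr => i _; rewrite scale1r.
Qed.

Lemma newman_ones (n : nat) : (0 < n)%N -> ones n \in newman.
Proof.
move=> n_gt0; apply/newmanP; split=> [i|]; rewrite coef_poly ?n_gt0 //.
by case: ifP.
Qed.

Lemma newman_Xn_add1 (n : nat) : (0 < n)%N -> 'X^n + 1 \in newman.
Proof.
move=> n_gt0; apply/newmanP; split=> [i|].
  by rewrite coefD coefXn coef1; case: eqP => [->|_]; case: eqP; lia.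
by rewrite coefD coefXn coef1 eqxx; case: eqP; lia.
Qed.

(** The two blocks of ones do not overlap: the first stops before exponent [s], the second starts at
    [s + r]. *)
Lemma newman_ones_gap (r s : nat) :
  (0 < s)%N -> ones s + 'X^(s + r) * ones (r - s) \in newman.
Proof.
move=> s_gt0; apply/newmanP; split=> [i|]; rewrite coefD coefXnM !coef_poly.
  case: (ltnP i s) => [lt_is|_]; first by rewrite ltn_addr.
  by case: ifP => // _; case: ifP.
by rewrite s_gt0 addn_gt0 s_gt0.
Qed.

Lemma newman_geom (r k : nat) (p q : {poly int}) :
  p \in newman -> q \in newman ->
  p.[3] = ((\sum_(0 <= i < r.+1) 'X^(i * k)) * q).[3] ->
  p * ('X^k - 1) = ('X^(r.+1 * k) - 1) * q.
Proof.
move=> pN qN eqpq.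
have eq3 : (p * ('X^k - 1)).[3] = (('X^(r.+1 * k) - 1) * q).[3].
  by rewrite -geom_sum_mul mulrAC !(hornerM _ ('X^k - 1)) eqpq.
(* Moving the negative terms across leaves digits at most 2 on both sides. *)
have eqXp : 'X^k * p + q = 'X^(r.+1 * k) * q + p.
  apply: (@digits_inj 3) => [i|i|]; rewrite ?newman_addXn_digit //.
  have -> : 'X^k * p + q = p * ('X^k - 1) + (p + q) by ring.
  by rewrite hornerD eq3 -hornerD; congr horner; ring.
have -> : p * ('X^k - 1) = 'X^k * p + q - (p + q) by ring.
by rewrite eqXp; ring.
Qed.

(** The factor ['X^k + 1] clears the signs, so both sides expand directly into sums of two shifted
    Newman polynomials. *)
Lemma newman_alt_geom (r k : nat) (p q : {poly int}) :
  p \in newman -> q \in newman ->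
  p.[3] = ((\sum_(0 <= i < (2 * r).+1) (-1) ^+ i * 'X^(i * k)) * q).[3] ->
  p * ('X^k + 1) = ('X^((2 * r).+1 * k) + 1) * q.
Proof.
move=> pN qN eqpq; rewrite mulrDr mulrDl mulr1 mul1r (mulrC p).
apply: (@digits_inj 3) => [i|i|]; rewrite ?newman_addXn_digit //.
have : (p * ('X^k + 1)).[3] = (('X^((2 * r).+1 * k) + 1) * q).[3].
  by rewrite -alt_geom_sum_mul mulrAC !(hornerM _ ('X^k + 1)) eqpq.
by rewrite mulrDr mulrDl mulr1 mul1r (mulrC p).
Qed.

Theorem theorem2p4 :
  (forall r : nat, (0 < r)%N ->
     (forall p q : {poly int}, p \in newman -> q \in newman ->
        3 ^+ r + 1 = (p.[3])%:Q / (q.[3])%:Q ->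
        p = ('X^r + 1) * q)
     /\ (exists p q : {poly int}, [/\ p \in newman, q \in newman &
        3 ^+ r + 1 = (p.[3])%:Q / (q.[3])%:Q]))
  /\
  (forall r k : nat, (0 < r)%N -> (0 < k)%N ->
     (forall p q : {poly int}, p \in newman -> q \in newman ->
        \sum_(0 <= i < r.+1) 3 ^+ (i * k) = (p.[3])%:Q / (q.[3])%:Q ->
        p = (\sum_(0 <= i < r.+1) 'X^(i * k)) * q
        /\ p%:F = ('X^(r.+1 * k) - 1)%:F / ('X^k - 1)%:F * q%:F)
     /\ (exists p q : {poly int}, [/\ p \in newman, q \in newman &
        \sum_(0 <= i < r.+1) 3 ^+ (i * k) = (p.[3])%:Q / (q.[3])%:Q]))
  /\
  (forall r k : nat, (0 < r)%N -> (0 < k)%N ->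
     (forall p q : {poly int}, p \in newman -> q \in newman ->
        \sum_(0 <= i < (2 * r).+1) (-1) ^+ i * 3 ^+ (i * k)
          = (p.[3])%:Q / (q.[3])%:Q ->
        p = (\sum_(0 <= i < (2 * r).+1) (-1) ^+ i * 'X^(i * k)) * q
        /\ p%:F = ('X^((2 * r).+1 * k) + 1)%:F / ('X^k + 1)%:F * q%:F)
     /\ (exists p q : {poly int}, [/\ p \in newman, q \in newman &
        \sum_(0 <= i < (2 * r).+1) (-1) ^+ i * 3 ^+ (i * k)
          = (p.[3])%:Q / (q.[3])%:Q]))
  /\
  (forall r s : nat, (0 < s)%N -> (s < r)%N ->
     (forall p q : {poly int}, p \in newman -> q \in newman ->
        3 ^+ r - 3 ^+ s + 1 = (p.[3])%:Q / (q.[3])%:Q ->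
        p = ('X^r - 'X^s + 1) * q)
     /\ (exists p q : {poly int}, [/\ p \in newman, q \in newman &
        3 ^+ r - 3 ^+ s + 1 = (p.[3])%:Q / (q.[3])%:Q])).
Proof.
have X1_neq0 : 'X - 1 != 0 :> {poly int} by rewrite polyXsubC_eq0.
split=> [r r_gt0|].
  have -> : 3 ^+ r + 1 = (('X^r + 1 : {poly int}).[3])%:Q.
    by rewrite !hornerE intrD rmorphXn.
  split=> [p q pN qN|].
    move/(newman_quotP _ _ _ qN); rewrite mulrDl mul1r; apply: digits_inj => i.
      exact: newman_digit.
    exact: newman_addXn_digit.
  (* From ['X^(2r) - 1 = ('X^r + 1) * ('X^r - 1)], with both differences divided by ['X - 1]. *)
  exists (ones (r + r)), (ones r); rewrite !newman_ones ?addn_gt0 ?r_gt0 //.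
  split=> //; apply/newman_quotP; first exact: newman_ones.
  congr horner; apply: (mulIf X1_neq0); rewrite -mulrA !ones_mul exprD.
  by ring.
split=> [r k r_gt0 k_gt0|].
  pose N : {poly int} := \sum_(0 <= i < r.+1) 'X^(i * k).
  have -> : \sum_(0 <= i < r.+1) 3 ^+ (i * k) = (N.[3])%:Q.
    rewrite /N horner_sum rmorph_sum /=; apply: eq_bigr => i _.
    by rewrite hornerXn rmorphXn.
  have Xk_neq0 : 'X^k - 1 != 0 :> {poly int}.
    by rewrite -polyC1 -polyCN XnaddC_neq0.
  split=> [p q pN qN|].
    move/(newman_quotP _ _ _ qN)/newman_geom => /(_ pN qN) eqp.
    split; last exact: frac_quotE.
    (* ['X^k - 1] is nonzero because [k > 0], so it can be cancelled from [eqp]. *)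
    by apply: (mulIf Xk_neq0); rewrite mulrAC geom_sum_mul.
  (* The ratio is [('X^(r.+1 * k) - 1) / ('X^k - 1)], the factors ['X - 1] cancelling. *)
  exists (ones (r.+1 * k)), (ones k); rewrite !newman_ones ?muln_gt0 //.
  split=> //; apply/newman_quotP; first exact: newman_ones.
  by congr horner; apply: (mulIf X1_neq0); rewrite -mulrA !ones_mul geom_sum_mul.
split=> [r k r_gt0 k_gt0|r s s_gt0 lt_sr].
  pose N : {poly int} := \sum_(0 <= i < (2 * r).+1) (-1) ^+ i * 'X^(i * k).
  have -> : \sum_(0 <= i < (2 * r).+1) (-1) ^+ i * 3 ^+ (i * k) = (N.[3])%:Q.
    rewrite /N horner_sum rmorph_sum /=; apply: eq_bigr => i _.
    rewrite -polyC1 -polyCN -polyC_exp mul_polyC hornerZ hornerXn.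
    by rewrite rmorphM !rmorphXn /= rmorphN.
  have Xk_neq0 : 'X^k + 1 != 0 :> {poly int} by rewrite -polyC1 XnaddC_neq0.
  split=> [p q pN qN|].
    move/(newman_quotP _ _ _ qN)/newman_alt_geom => /(_ pN qN) eqp.
    split; last exact: frac_quotE.
    by apply: (mulIf Xk_neq0); rewrite mulrAC alt_geom_sum_mul.
  (* Numerator and denominator of the closed form are already Newman here. *)
  exists ('X^((2 * r).+1 * k) + 1), ('X^k + 1).
  rewrite !newman_Xn_add1 ?muln_gt0 //; split=> //.
  apply/newman_quotP; first exact: newman_Xn_add1.
  by rewrite alt_geom_sum_mul.
have -> : 3 ^+ r - 3 ^+ s + 1 = (('X^r - 'X^s + 1 : {poly int}).[3])%:Q.
  by rewrite !hornerE intrD rmorphB /= !rmorphXn.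
split=> [p q pN qN|].
  move/(newman_quotP _ _ _ qN) => eqpq.
  (* Only [- 'X^s * q] is negative; once transposed, all digits are at most 2. *)
  suff eqXq : 'X^s * q + p = 'X^r * q + q.
    by apply: (addrI ('X^s * q)); rewrite eqXq; ring.
  apply: (@digits_inj 3) => [i|i|]; rewrite ?newman_addXn_digit //.
  by rewrite hornerD eqpq !hornerE; ring.
(* (x^r - x^s + 1)(x^r - 1) = (x^s - 1) + x^(r+s) (x^(r-s) - 1) *)
exists (ones s + 'X^(s + r) * ones (r - s)), (ones r).
have r_gt0 : (0 < r)%N by apply: leq_trans lt_sr.
rewrite newman_ones_gap // newman_ones //; split=> //.
apply/newman_quotP; first exact: newman_ones.
congr horner; apply: (mulIf X1_neq0).
rewrite mulrDl -!mulrA !ones_mul mulrBr -exprD mulr1.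
(* Subtraction on [nat] is truncated; [s < r] makes it exact. *)
have -> : (s + r + (r - s) = r + r)%N by lia.
by rewrite !exprD; ring.
Qed.
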